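(* Let $R$ be a ring and let $M$ be a nonzero left $R$-module. The following statements are equivalent: (1) $M$ is $R\text{-pr}$-co-first, i.e. for every preradical $\alpha$ on $R\text{-Mod}$, either $\alpha(M)=M$ or $M$ has no nonzero quotient $Q$ with $\alpha(Q)=Q$. (2) $M$ is coprime.
   Context: $R$ is an associative ring with identity; modules are left $R$-modules and $R\text{-Mod}$ is their category. A preradical on $R\text{-Mod}$ is a functor $\sigma:R\text{-Mod}\to R\text{-Mod}$ with $\sigma(M)\le M$ for every $M$ and, for every homomorphism $f:M\to N$, $f(\sigma(M))\le\sigma(N)$, where $\sigma(f)$ is the restriction of $f$. $R\text{-pr}$ denotes the collection of all preradicals. For a module $M$, let $\xi(M)=\{K\mid \text{there is an epimorphism } M^{(X)}\to K \text{ for some set } X\}$ (the pretorsion class generated by $M$). A module $M$ is coprime if every nonzero quotient $Q$ of $M$ generates the pretorsion class $\xi(M)$, i.e. $\xi(Q)=\xi(M)$. *)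

(* Defs.v *)
From HB Require Import structures.
From mathcomp Require Import all_boot all_algebra.
From mathcomp Require Import boolp classical_sets functions cardinality.

Set Implicit Arguments.
Unset Strict Implicit.
Unset Printing Implicit Defensive.
Import GRing.Theory.
Local Open Scope classical_set_scope.
Local Open Scope ring_scope.

Section DirectPower.
Variables (R : pzRingType) (X : Type) (M : lmodType R).

Definition finsupp_fun : {pred X -> M} :=
  fun f => `[< finite_set [set x | f x != 0] >].

Lemma finsupp_fun_submod_closed : submod_closed finsupp_fun.
Proof.
split=> [|a f g /asboolP Ff /asboolP Fg]; apply/asboolP.
  rewrite (_ : [set x | _] = set0) ?finite_set0//.
  by apply/seteqP; split=> x //=; rewrite eqxx.
apply: (@sub_finite_set _ _ ([set x | f x != 0] `|` [set x | g x != 0])).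
  move=> x /= fgx; apply: contrapT => /not_orP[/negP fx /negP gx].
  move: fx gx fgx; rewrite !negbK => /eqP fx /eqP gx.
  by rewrite /GRing.add /GRing.scale /= fx gx scaler0 addr0 eqxx.
by rewrite finite_setU.
Qed.

HB.instance Definition _ :=
  GRing.isSubmodClosed.Build R (X -> M)%type finsupp_fun
    finsupp_fun_submod_closed.

(* The direct sum M^(X), as the submodule of finitely supported functions of
   the full power X -> M. *)
Record dpower := Dpower {
  dpower_val :> X -> M ;
  dpower_finsupp : dpower_val \in finsupp_fun }.

HB.instance Definition _ := [isSub for dpower_val].
HB.instance Definition _ := [Choice of dpower by <:].
HB.instance Definition _ := [SubChoice_isSubLmodule of dpower by <:].

End DirectPower.

Section Preradicals.
Variable R : pzRingType.

(* The value of the functor on f : M -> N is the restriction of f to pr M,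
   which [pr_hom] makes well defined; the functor laws are then automatic. *)
Record preradical := Preradical {
  pr :> forall M : lmodType R, submodClosed M ;
  pr_hom : forall (M N : lmodType R) (f : {linear M -> N}) (x : M),
    x \in pr M -> f x \in pr N }.

(* alpha(M) = M *)
Definition pr_full (alpha : preradical) (M : lmodType R) : Prop :=
  forall x : M, x \in alpha M.

Definition nonzero_module (M : lmodType R) : Prop := exists x : M, x != 0.

(* Quotients are taken up to isomorphism, as epimorphic images. *)
Definition is_quotient (M Q : lmodType R) : Prop :=
  exists f : {linear M -> Q}, set_surj setT setT f.

Definition xi (M K : lmodType R) : Prop :=
  exists X : Type, is_quotient (dpower X M) K.

Definition pr_cofirst (M : lmodType R) : Prop :=
  forall alpha : preradical,
    pr_full alpha M \/
    ~ (exists Q : lmodType R,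
         [/\ nonzero_module Q, is_quotient M Q & pr_full alpha Q]).

Definition coprime_module (M : lmodType R) : Prop :=
  forall Q : lmodType R, nonzero_module Q -> is_quotient M Q ->
    forall K : lmodType R, xi Q K <-> xi M K.

End Preradicals.

(* Main.v *)
Require Import Defs.
From mathcomp Require Import all_boot all_algebra.
From HB Require Import structures.
From mathcomp Require Import finmap.
From mathcomp Require Import boolp classical_sets functions cardinality fsbigop.

(** Both conditions say that every nonzero quotient Q of M generates M.

    The bridge between preradicals and pretorsion classes is [xiP]: K lies in
    xi(A) iff every preradical alpha with alpha(A) = A satisfies alpha(K) = K.
    One direction holds because A^(X) is spanned by the images of its canonical
    injections A -> A^(X), and preradicals are preserved by homomorphisms.  For
    the other it is enough to test one preradical, the trace of A, which sends
    K to the sum of the images of all homomorphisms A -> K: if this sum is K,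
    these homomorphisms together define an epimorphism onto K from the direct
    sum of copies of A indexed by Hom(A, K).

    If M is co-first, apply the hypothesis to the trace of a nonzero quotient Q:
    it fixes Q, so it must fix M, that is M lies in xi(Q).  As Q is a quotient
    of M, the preradicals fixing M and those fixing Q then coincide, and so do
    xi(M) and xi(Q) by [xiP].  Conversely, if M is coprime and alpha(Q) = Q for
    a nonzero quotient Q, then M lies in xi(M) = xi(Q), hence alpha(M) = M. *)

Set Implicit Arguments.
Unset Strict Implicit.
Unset Printing Implicit Defensive.
Import GRing.Theory.
Local Open Scope classical_set_scope.
Local Open Scope ring_scope.

(** * The direct power as a coproduct *)

Section Coproduct.
Variables (R : pzRingType) (X : choiceType) (A : lmodType R).
Implicit Types (g : dpower X A) (x : X).

Lemma dpower_finite_support g : finite_set [set x | g x != 0].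
Proof. exact/asboolP/(dpower_finsupp g). Qed.

Definition dsupp g : {fset X} := fset_set [set x | g x != 0].

Lemma dsuppPn g x : x \notin dsupp g -> g x = 0.
Proof.
rewrite in_fset_set; last exact: dpower_finite_support.
by rewrite notin_setE /= => /negP; rewrite negbK => /eqP.
Qed.

Definition single_fun x (a : A) : X -> A := fun y => if y == x then a else 0.

Lemma single_finsupp x a : single_fun x a \in @finsupp_fun R X A.
Proof.
apply/asboolP; apply: (@sub_finite_set _ _ [set x]) => // y /=.
by rewrite /single_fun; case: (y =P x) => // _; rewrite eqxx.
Qed.

Definition single x (a : A) : dpower X A := Dpower (single_finsupp x a).

Fact single_is_linear x : linear (single x).
Proof.
move=> k a b; apply/val_inj/funext => y /=.
rewrite /single_fun /GRing.add /GRing.scale /= /single_fun.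
by case: (y =P x) => // _; rewrite scaler0 addr0.
Qed.

HB.instance Definition _ x :=
  GRing.isLinear.Build R A (dpower X A) _ (single x) (single_is_linear x).

(** A^(X) is spanned by its canonical injections, so that membership in a
    submodule of A^(X) can be tested on homomorphisms out of A. *)
Lemma dpower_sum_single g : g = \sum_(x <- dsupp g) single x (g x).
Proof.
apply/val_inj/funext => y; rewrite raddf_sum /= fct_sumE /= /single_fun.
rewrite -big_mkcond /= -big_filter.
have [yg|yg] := boolP (y \in dsupp g).
  by rewrite (eq_filter (a2 := pred1 y)) ?filter_pred1_uniq ?big_seq1 ?fset_uniq.
rewrite big1_seq; first exact: dsuppPn.
by move=> x; rewrite mem_filter => /andP[_ /andP[/eqP <-]]; rewrite (negPf yg).
Qed.

Section Induced.
Variables (K : lmodType R) (f : X -> {linear A -> K}).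

(** The homomorphism out of A^(X) given by the universal property of the
    coproduct. *)
Definition copair g : K := \sum_(x \in [set: X]) f x (g x).

(** Replacing the support by an arbitrary larger finite set lets the sums for
    several elements of A^(X) range over one index set, as additivity needs. *)
Lemma copairE (s : {fset X}) g :
  (forall x, x \notin s -> g x = 0) -> copair g = \sum_(x <- s) f x (g x).
Proof. by move=> sg; apply: fsbigTE => x /sg ->; rewrite linear0. Qed.

Fact copair_is_linear : linear copair.
Proof.
move=> k g h; pose s := (dsupp g `|` dsupp h)%fset.
have sg x : x \notin s -> g x = 0.
  by rewrite in_fsetU negb_or => /andP[/dsuppPn].
have sh x : x \notin s -> h x = 0.
  by rewrite in_fsetU negb_or => /andP[_ /dsuppPn].
have valE x : (k *: g + h) x = k *: g x + h x by [].
rewrite (copairE sg) (copairE sh) (@copairE s); last first.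
  by move=> x xs; rewrite valE sg// sh// scaler0 addr0.
rewrite scaler_sumr -big_split /=.
by apply: eq_bigr => x _; exact: linearP.
Qed.

HB.instance Definition _ :=
  GRing.isLinear.Build R (dpower X A) K _ copair copair_is_linear.

Lemma copair_single x a : copair (single x a) = f x a.
Proof.
rewrite (@copairE [fset x]%fset) ?big_seq_fset1 /= /single_fun ?eqxx// => y.
by rewrite in_fset1 => /negPf ->.
Qed.

End Induced.
End Coproduct.

(** * The trace preradical and pretorsion classes *)

Section Trace.
Variable R : pzRingType.
Implicit Types (A K L Q : lmodType R) (alpha : preradical R).

Lemma quotient_full alpha K Q :
  is_quotient K Q -> pr_full alpha K -> pr_full alpha Q.
Proof.
move=> [f fsurj] fullK y; have [x _ <-] := fsurj y I.
exact: pr_hom.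
Qed.

(** A^(X) inherits alpha(A) = A because its elements are sums of images of
    elements of A under the canonical injections; a quotient of A^(X) inherits
    it in turn. *)
Lemma xi_full alpha A K : xi A K -> pr_full alpha A -> pr_full alpha K.
Proof.
move=> [X AK] fullA; apply: (quotient_full AK) => g.
rewrite [g](@dpower_sum_single R {classic X} A).
apply: rpred_sum => x _; exact: pr_hom.
Qed.

(** The sum of the images of all homomorphisms A -> K.  A term of the sum is
    recorded as a homomorphism paired with its argument, so that scalars can be
    absorbed by the argument. *)
Definition trace_pred A K : {pred K} := fun y =>
  `[< exists s : seq ({linear A -> K} * A), y = \sum_(p <- s) p.1 p.2 >].

Arguments trace_pred : clear implicits.

Fact trace_submod_closed A K : submod_closed (trace_pred A K).
Proof.
split=> [|k y z /asboolP[s ->] /asboolP[t ->]]; apply/asboolP.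
  by exists [::]; rewrite big_nil.
exists ([seq (p.1, k *: p.2) | p <- s] ++ t).
rewrite big_cat big_map scaler_sumr; congr (_ + _).
by apply: eq_bigr => p _; rewrite linearZ.
Qed.

HB.instance Definition _ A K :=
  GRing.isSubmodClosed.Build R K (trace_pred A K) (trace_submod_closed A K).

Fact trace_hom A K L (f : {linear K -> L}) y :
  y \in trace_pred A K -> f y \in trace_pred A L.
Proof.
move=> /asboolP[s ->]; apply/asboolP.
exists [seq (GRing.Linear.clone _ _ _ _ (f \o p.1) _, p.2)
       | p : {linear A -> K} * A <- s].
by rewrite raddf_sum big_map.
Qed.

Definition trace A : preradical R :=
  @Preradical R (fun K => trace_pred A K : submodClosed K) (@trace_hom A).

Lemma trace_self A : pr_full (trace A) A.
Proof.
move=> a; apply/asboolP.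
by exists [:: (idfun : {linear A -> A}, a)]; rewrite big_seq1.
Qed.

(** The index set of the direct power is Hom(A, K) itself, and the epimorphism
    is evaluation: the copy of A at index h is mapped to K by h. *)
Lemma trace_full_xi A K : pr_full (trace A) K -> xi A K.
Proof.
move=> fullK; pose X := {classic {linear A -> K}}.
pose f (x : X) : {linear A -> K} := x.
exists X, (copair f : {linear dpower X A -> K}) => y _.
have /asboolP[s ->] := fullK y.
exists (\sum_(p <- s) single (p.1 : X) p.2) => //.
rewrite raddf_sum; apply: eq_bigr => p _; exact: copair_single.
Qed.

(** Pretorsion classes are determined by the preradicals that fix their
    generator; the trace of A alone already detects xi(A). *)
Lemma xiP A K :
  xi A K <-> forall alpha, pr_full alpha A -> pr_full alpha K.
Proof.
split=> [AK alpha|AK]; first exact: xi_full.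
exact/trace_full_xi/AK/trace_self.
Qed.

End Trace.

Theorem proposition3p10 (R : pzRingType) (M : lmodType R)
    (M_neq0 : nonzero_module M) :
  pr_cofirst M <-> coprime_module M.
Proof.
split=> [cofirstM Q Q0 MQ K|coprimeM alpha].
  have xiQM : xi Q M.
    apply: trace_full_xi; have [//|[]] := cofirstM (trace Q).
    by exists Q; split=> //; apply: trace_self.
  rewrite !xiP; split=> KP alpha fullA; apply: KP.
    exact: quotient_full MQ fullA.
  exact: xi_full xiQM fullA.
have [?|nfullM] := pselect (pr_full alpha M); [by left|right].
move=> [Q [Q0 MQ fullQ]]; apply: nfullM; move: fullQ; apply: xi_full.
by apply/(coprimeM Q Q0 MQ)/xiP.
Qed.
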